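(* Let $G=(V,E)$ be a finite undirected graph (unweighted, or with positive edge weights) with $n=|V|\ge 2$, and let $G'$ be obtained from $G$ by a batch $\beta$ of edge insertions and/or edge-weight decreases, with $\mathit{VD}(G)\ge\mathit{VD}(G')$. Let $\epsilon,\delta\in(0,1)$ and $$r=\frac{c}{\epsilon^2}\Big(\big\lfloor\log_2(\mathit{VD}(G)-2)\big\rfloor+1+\ln\tfrac{1}{\delta}\Big).$$ Let $S=\{p_{(1)},\dots,p_{(r)}\}$ be $r$ independent shortest paths of $G$ sampled according to $\pi_G$. Build $S'=\{p'_{(1)},\dots,p'_{(r)}\}$ by replacing each $p_{(k)}$, associated with its pair $(s,t)$, as follows: keep $p'_{(k)}=p_{(k)}$ if the distance and the number of shortest paths from $s$ to $t$ are the same in $G'$ as in $G$; otherwise choose $p'_{(k)}$ uniformly at random among the shortest $s$–$t$ paths of $G'$. For $v\in V$ let $\tilde c'_B(v)$ be the fraction of the paths in $S'$ of which $v$ is an internal node, and let $c'_B(v)$ be the exact betweenness of $v$ in $G'$. Then $$\Pr\big(\exists v\in V:\ |c'_B(v)-\tilde c'_B(v)|>\epsilon\big)<\delta.$$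
   Context: The vertex diameter $\mathit{VD}(H)$ of a graph $H$ is the maximum, over all shortest paths of $H$, of the number of nodes on the path. Normalized betweenness: $c_B(v)=\frac{1}{n(n-1)}\sum_{s\neq v\neq t}\frac{\sigma_{st}(v)}{\sigma_{st}}$, where $\sigma_{st}$ is the number of shortest $s$–$t$ paths and $\sigma_{st}(v)$ the number of them passing through $v$ (terms with $\sigma_{st}=0$ are $0$). Sampling according to $\pi_G$: choose an ordered pair $(s,t)$ of distinct nodes uniformly at random, then (if $t$ is reachable from $s$) a shortest $s$–$t$ path uniformly at random; so each shortest path $p_{st}$ has probability $\frac{1}{n(n-1)\sigma_{st}}$. The constant $c\approx 0.5$ is the universal constant in the Riondato–Kornaropoulos sample-size bound, which states: if $r\ge\frac{c}{\epsilon^2}(\lfloor\log_2(\mathit{VD}(H)-2)\rfloor+1+\ln\frac1\delta)$ independent shortest paths are sampled according to $\pi_H$ and $\tilde c_B(v)$ is the fraction of them having $v$ as internal node, then $\Pr(\exists v:|c_B(v)-\tilde c_B(v)|>\epsilon)<\delta$. *)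

(* Defs.v *)
From mathcomp Require Import all_boot all_order all_algebra.
From mathcomp Require Import reals ereal exp.

Set Implicit Arguments.
Unset Strict Implicit.
Unset Printing Implicit Defensive.

Import Order.TTheory GRing.Theory Num.Theory.

Local Open Scope ring_scope.

(* Finite simple undirected graph with positive edge weights; an unweighted
   graph is one whose edges all have weight 1.  The values of [weight] outside
   [edge] are irrelevant. *)
Record wgraph (R : realType) (V : finType) := WGraph {
  edge : rel V;
  weight : V -> V -> R;
  edge_sym : symmetric edge;
  edge_irr : irreflexive edge;
  weight_sym : forall x y, edge x y -> weight x y = weight y x;
  weight_gt0 : forall x y, edge x y -> 0 < weight x y
}.

(* A path is given by its sequence of pairwise distinct nodes, hence has at
   most #|V| of them. *)
Definition vpath (V : finType) : finType := {bseq #|V| of V}.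

Definition internal (V : finType) (p : seq V) : seq V :=
  if p is x :: q then behead (belast x q) else [::].

Section Graph.
Variables (R : realType) (V : finType) (G : wgraph R V).

Definition is_path (s t : V) (p : seq V) : bool :=
  if p is x :: q then [&& x == s, last x q == t, path (edge G) x q & uniq p]
  else false.

Definition path_length (p : seq V) : R :=
  if p is x :: q then \sum_(w <- pairmap (weight G) x q) w else 0.

Definition dist (s t : V) : \bar R :=
  \big[Order.min/+oo%E]_(p : vpath V | is_path s t p) (path_length p)%:E.

Definition shortest_paths (s t : V) : {set vpath V} :=
  [set p : vpath V | is_path s t p & (path_length p)%:E == dist s t].

Definition sigma (s t : V) : nat := #|shortest_paths s t|.

Definition sigma_through (v s t : V) : nat :=
  #|[set p in shortest_paths s t | v \in (p : seq V)]|.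

Definition VD : nat :=
  (\max_(st : V * V) \max_(p in shortest_paths st.1 st.2) size p)%N.

(* Terms with [sigma s t = 0] vanish since x / 0 = 0. *)
Definition betweenness (v : V) : R :=
  (#|V| * (#|V| - 1))%N%:R^-1 *
  \sum_(s | s != v) \sum_(t | v != t)
     (sigma_through v s t)%:R / (sigma s t)%:R.

End Graph.

(* Finite probability: a law on a finite type is given by its mass function. *)
Definition Pr (R : realType) (T : finType) (mu : T -> R) (E : pred T) : R :=
  \sum_(x | E x) mu x.

Definition uniform (R : realType) (T : finType) (A : {set T}) (x : T) : R :=
  (x \in A)%:R / #|A|%:R.

(* Outcome of one draw: the ordered pair (s, t), and the chosen path, [None]
   when t is not reachable from s. *)
Definition sample (V : finType) : finType := (V * V * option (vpath V))%type.

Section Sampling.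
Variables (R : realType) (V : finType).
Implicit Type G : wgraph R V.

Definition choose_path G (s t : V) (o : option (vpath V)) : R :=
  if o is Some p then uniform R (shortest_paths G s t) p
  else (shortest_paths G s t == set0)%:R.

Definition pi_law G (x : sample V) : R :=
  uniform R [set st : V * V | st.1 != st.2] x.1 * choose_path G x.1.1 x.1.2 x.2.

Definition iid_law G (r : nat) (S : {ffun 'I_r -> sample V}) : R :=
  \prod_(k < r) pi_law G (S k).

Definition unchanged G G' (s t : V) : bool :=
  (dist G' s t == dist G s t) && (sigma G' s t == sigma G s t).

Definition replace_law G G' (x : sample V) (o' : option (vpath V)) : R :=
  if unchanged G G' x.1.1 x.1.2 then (o' == x.2)%:R
  else choose_path G' x.1.1 x.1.2 o'.

(* Joint law of (S, S'): S is drawn first, then, given S, the replacements are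
   drawn independently of each other. *)
Definition updated_law G G' (r : nat)
    (SS' : {ffun 'I_r -> sample V} * {ffun 'I_r -> option (vpath V)}) : R :=
  iid_law G SS'.1 * \prod_(k < r) replace_law G G' (SS'.1 k) (SS'.2 k).

Definition estimate (r : nat) (S : 'I_r -> option (vpath V)) (v : V) : R :=
  #|[set k | if S k is Some p then v \in internal p else false]|%:R / r%:R.

Definition bad_estimate G (eps : R) (r : nat) (S : 'I_r -> option (vpath V)) :
    bool :=
  [exists v, `|betweenness G v - estimate S v| > eps].

(* [beta] is the set of modified edges, each in both orientations (which the
   symmetry of G and G' forces): those that are not in G are inserted, the
   weights of the others are decreased, and nothing else changes. *)
Definition incremental_batch G (beta : {set V * V}) G' : Prop :=
  forall x y,
    if (x, y) \in beta then
      edge G' x y /\ (edge G x y -> weight G' x y < weight G x y)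
    else
      edge G' x y = edge G x y /\ (edge G x y -> weight G' x y = weight G x y).

End Sampling.

(* Since [ln] is 0 on nonpositive reals, the term floor(log2(vd - 2)) is 0 for
   vd <= 2, where shortest paths have no internal node. *)
Definition sample_bound (R : realType) (c eps delta : R) (vd : nat) : R :=
  c / eps ^+ 2 *
  ((Num.floor (ln (vd%:R - 2 : R) / ln 2))%:~R + 1 + ln (1 / delta)).

Definition sample_size (R : realType) (c eps delta : R) (vd : nat) : nat :=
  `|Num.ceil (sample_bound c eps delta vd)|%N.

(* [c] is an admissible universal constant in the Riondato-Kornaropoulos
   sample-size bound. *)
Definition RK_constant (R : realType) (c : R) : Prop :=
  0 < c /\
  forall (V : finType) (H : wgraph R V) (eps delta : R) (r : nat),
    (1 < #|V|)%N -> 0 < eps < 1 -> 0 < delta < 1 ->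
    sample_bound c eps delta (VD H) <= r%:R ->
    Pr (iid_law H (r := r))
       [pred S : {ffun 'I_r -> sample V} |
          bad_estimate H eps (fun k => (S k).2)] < delta.

(* Main.v *)
Require Import Defs.
From mathcomp Require Import all_boot all_order all_algebra.
From mathcomp Require Import reals ereal exp.

(** Since a batch only inserts edges and decreases weights, every shortest path
    of [G] remains a path of [G'] that is no longer than before, so when the
    distance is unchanged it is still shortest; when moreover the number of
    shortest paths is unchanged, the two sets of shortest paths coincide.
    Hence each updated path is, together with its pair, distributed according
    to [pi_G'], independently of the others, and the Riondato-Kornaropoulos
    bound for [G'] applies because the sample size is nondecreasing in the
    vertex diameter. *)

Set Implicit Arguments.
Unset Strict Implicit.
Unset Printing Implicit Defensive.

Import Order.TTheory GRing.Theory Num.Theory.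

Local Open Scope ring_scope.

Section IncrementalBatch.
Variables (R : realType) (V : finType) (G G' : wgraph R V) (beta : {set V * V}).
Hypothesis hbeta : incremental_batch G beta G'.

Lemma batch_edge x y :
  edge G x y -> edge G' x y /\ weight G' x y <= weight G x y.
Proof.
move=> Gxy; have := hbeta x y; case: ifP => _ [e w].
  by split=> //; apply/ltW/w.
by rewrite e; split=> //; rewrite w.
Qed.

Lemma batch_is_path s t p : is_path G s t p -> is_path G' s t p.
Proof.
case: p => //= x q /and4P[-> -> Gq ->]; rewrite andbT /=.
by apply: sub_path Gq => u v /batch_edge[].
Qed.

Lemma batch_path_length s t p :
  is_path G s t p -> path_length G' p <= path_length G p.
Proof.
case: p => //= x q /and4P[_ _ Gq _].
elim: q x Gq => [|y q IHq] x /=; first by rewrite !big_nil.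
by move=> /andP[/batch_edge[_ w] Gq]; rewrite !big_cons lerD ?IHq.
Qed.

Lemma dist_le_path_length (H : wgraph R V) s t (p : vpath V) :
  is_path H s t p -> (dist H s t <= (path_length H p)%:E)%O.
Proof. by move=> Hp; rewrite /dist; apply: bigmin_le_cond. Qed.

Lemma unchanged_shortest_paths s t :
  unchanged G G' s t -> shortest_paths G' s t = shortest_paths G s t.
Proof.
move=> /andP[/eqP dE /eqP sE]; apply/esym/eqP.
(* With equal finite cardinalities, only the inclusion of the old set in the new one is left to
   prove. *)
rewrite eqEcard -[X in (X <= _)%N]/(sigma G' s t) sE leqnn andbT.
apply/subsetP => p; rewrite !inE => /andP[Gp /eqP lp].
have G'p := batch_is_path Gp; rewrite G'p eq_le dist_le_path_length // andbT.
by rewrite dE -lp lee_fin (batch_path_length Gp).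
Qed.

End IncrementalBatch.

Lemma big_option (R : Type) (idx : R) (op : Monoid.com_law idx) (T : finType)
    (F : option T -> R) :
  \big[op/idx]_o F o = op (F None) (\big[op/idx]_x F (Some x)).
Proof.
rewrite (bigD1 None) //=; congr (op _ _).
by rewrite (reindex_omap Some id) => [|[]//]; apply: eq_bigl => x; rewrite eqxx.
Qed.

Section Laws.
Variables (R : realType) (V : finType).
Implicit Type G : wgraph R V.

Lemma choose_path_sum1 G s t : \sum_o choose_path G s t o = 1.
Proof.
rewrite big_option /= /uniform -mulr_suml -natr_sum.
have -> : (\sum_p (p \in shortest_paths G s t))%N = #|shortest_paths G s t|.
  by rewrite -sum1_card [RHS]big_mkcond; apply: eq_bigr => p _; case: (p \in _).
(* If [t] is unreachable, the uniform part is 0 / 0 = 0 and [None] carries all the mass. *)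
have [->|A0] := eqVneq; first by rewrite cards0 mul0r addr0.
by rewrite add0r mulfV // pnatr_eq0 cards_eq0.
Qed.

(** For an unchanged pair the kernel is a point mass and both graphs give the same uniform law;
    otherwise the new path ignores the old one, whose law sums to 1. *)
Lemma replace_choose_path G G' (beta : {set V * V}) s t o' :
  incremental_batch G beta G' ->
  \sum_o choose_path G s t o * replace_law G G' (s, t, o) o' =
  choose_path G' s t o'.
Proof.
move=> hbeta; rewrite /replace_law /=; case unch: unchanged.
  rewrite (bigD1 o') //= eqxx mulr1 big1 ?addr0 => [|o ne].
    by rewrite /choose_path (unchanged_shortest_paths hbeta unch).
  by rewrite eq_sym (negbTE ne) mulr0.
by rewrite -mulr_suml choose_path_sum1 mul1r.
Qed.

(** Replacement keeps the pair, which is uniform under both laws, so it suffices to compare path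
    laws pair by pair. *)
Lemma replace_pi_law G G' (beta : {set V * V}) o' :
  incremental_batch G beta G' ->
  \sum_x pi_law G x * replace_law G G' x o' =
  \sum_(x : sample V | x.2 == o') pi_law G' x.
Proof.
move=> hbeta.
rewrite -(pair_bigA _ (fun st o =>
  pi_law G (st, o) * replace_law G G' (st, o) o')).
rewrite -(pair_big_dep predT (fun _ o => o == o')
  (fun st o => pi_law G' (st, o))).
apply: eq_bigr => -[s t] _; rewrite big_pred1_eq /pi_law /=.
under eq_bigr do rewrite -mulrA.
by rewrite -mulr_sumr (replace_choose_path _ _ _ hbeta).
Qed.

Lemma eq_bad_estimate G eps r (S T : 'I_r -> option (vpath V)) :
  S =1 T -> bad_estimate G eps S = bad_estimate G eps T.
Proof.
move=> eqST; apply: eq_existsb => v; congr (_ < `|_ - _ / _|).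
by congr (_%:R); apply: eq_card => k; rewrite !inE eqST.
Qed.

End Laws.

Section ProductLaws.
Variables (R : comNzRingType) (T U : finType) (r : nat).

(** Summing out the first family and distributing the product over the sum shows that independent
    replacements of independent draws stay independent. *)
Lemma sum_prod_kernel (mu : T -> R) (K : T -> U -> R)
    (E : pred {ffun 'I_r -> U}) :
  \sum_(x : {ffun 'I_r -> T} * {ffun 'I_r -> U} | E x.2)
     \prod_k mu (x.1 k) * \prod_k K (x.1 k) (x.2 k) =
  \sum_(u | E u) \prod_k \sum_x mu x * K x (u k).
Proof.
rewrite -(pair_big_dep predT (fun _ u => E u)
  (fun (s : {ffun 'I_r -> T}) (u : {ffun 'I_r -> U}) =>
     \prod_k mu (s k) * \prod_k K (s k) (u k))) exchange_big /=.
apply: eq_bigr => u _; rewrite bigA_distr_bigA.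
by apply: eq_bigr => s _; rewrite -big_split.
Qed.

(** The image of a product law under a coordinatewise map is the product of the image laws; with
    [f := snd] this forgets the pairs. *)
Lemma sum_prod_image (mu : T -> R) (f : T -> U) (E : pred {ffun 'I_r -> U}) :
  \sum_(s : {ffun 'I_r -> T} | E [ffun k => f (s k)]) \prod_k mu (s k) =
  \sum_(u | E u) \prod_k \sum_(x | f x == u k) mu x.
Proof.
rewrite (partition_big (fun s : {ffun 'I_r -> T} => [ffun k => f (s k)]) E) //.
apply: eq_bigr => u Eu; rewrite bigA_distr_big_dep; apply: eq_bigl => s.
apply/andP/familyP => [[_ /eqP <-] k|fs]; first by rewrite unfold_in ffunE.
suff -> : [ffun k => f (s k)] = u by [].
by apply/ffunP => k; rewrite ffunE; apply/eqP/fs.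
Qed.

End ProductLaws.

Section SampleSize.
Variables (R : realType) (c eps delta : R).
Hypothesis c_gt0 : 0 < c.

Lemma ln_nat_sub2_ge0 (m : nat) : 0 <= ln (m%:R - 2 : R).
Proof.
have [m2|m2] := leqP m 2; first by rewrite ln0 // subr_le0 ler_nat.
by rewrite ln_ge0 // lerBrDr nat1r ler_nat.
Qed.

(** The default value 0 of [ln] for [m <= 2] does not break monotonicity: from 3 on, the argument is
    at least 1 and its logarithm nonnegative. *)
Lemma ln_nat_sub2_le (m n : nat) :
  (m <= n)%N -> ln (m%:R - 2 : R) <= ln (n%:R - 2 : R).
Proof.
move=> mn; have [m2|m2] := leqP m 2.
  by rewrite ln0 ?ln_nat_sub2_ge0 // subr_le0 ler_nat.
by rewrite ler_ln ?lerB ?ler_nat // posrE subr_gt0 ltr_nat // (leq_trans m2).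
Qed.

Lemma sample_bound_le (m n : nat) :
  (m <= n)%N -> sample_bound c eps delta m <= sample_bound c eps delta n.
Proof.
move=> mn; rewrite /sample_bound ler_wpM2l //.
  by rewrite divr_ge0 ?sqr_ge0 // ltW.
rewrite !lerD2r ler_int le_floor // ler_pM2r ?ln_nat_sub2_le //.
by rewrite invr_gt0 ln_gt0 // ltr1n.
Qed.

Lemma sample_bound_le_size (m : nat) :
  sample_bound c eps delta m <= (sample_size c eps delta m)%:R.
Proof.
apply: le_trans (ceil_ge _) _.
(* The absolute value dominates the ceiling whatever its sign. *)
by rewrite /sample_size natr_absz ler_int ler_norm.
Qed.

End SampleSize.

Theorem theorem1 (R : realType) (c : R) (V : finType) (G G' : wgraph R V)
    (beta : {set V * V}) (eps delta : R) (r : nat)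
    (hc : RK_constant c)
    (hn : (2 <= #|V|)%N)
    (hbeta : incremental_batch G beta G')
    (hVD : (VD G' <= VD G)%N)
    (heps : 0 < eps < 1)
    (hdelta : 0 < delta < 1)
    (hr : r = sample_size c eps delta (VD G)) :
  Pr (updated_law G G' (r := r))
     [pred SS' : {ffun 'I_r -> sample V} * {ffun 'I_r -> option (vpath V)} |
        bad_estimate G' eps SS'.2] < delta.
Proof.
have [c_gt0 RK] := hc.
have r_ge : sample_bound c eps delta (VD G') <= r%:R.
  by rewrite hr (le_trans _ (sample_bound_le_size _ _ _ _)) ?sample_bound_le.
apply: le_lt_trans (RK V G' eps delta r hn heps hdelta r_ge).
pose bad := [pred u : {ffun 'I_r -> option (vpath V)} | bad_estimate G' eps u].
have := sum_prod_image (pi_law G') snd bad.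
rewrite /Pr /iid_law => RKE.
(* The event depends on the draws only through their paths, so it is a preimage under [snd]. *)
rewrite [X in _ <= X](eq_bigl (fun S : {ffun 'I_r -> sample V} =>
   bad [ffun k => (S k).2])) => [|S]; last first.
  by apply: eq_bad_estimate => k; rewrite ffunE.
rewrite RKE /updated_law /iid_law.
(* Both sides are now sums over path families of products of one-draw masses, and they agree factor
   by factor. *)
rewrite (sum_prod_kernel (pi_law G) (replace_law G G') bad) le_eqVlt.
apply/orP; left; apply/eqP; apply: eq_bigr => u _; apply: eq_bigr => k _.
exact: replace_pi_law hbeta.
Qed.
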